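(* Let $n\ge 5$ and $r\ge 2$ be integers with $r<n$ and $n\equiv r-1\pmod 2$. Then $G_{n,r}$ is an $(r-1)$-STI graph.
   Context: The transmission of a vertex $u$ of a connected graph $G$ is $\mathrm{Tr}_G(u)=\sum_{x\in V(G)} d_G(u,x)$, where $d_G$ is the shortest-path distance. For an integer $k\ge 1$, a connected finite simple graph $G$ is a $k$-STI graph if $|\mathrm{Tr}_G(x)-\mathrm{Tr}_G(y)|=k$ for every edge $xy\in E(G)$. For integers $n\ge 5$ and $2\le r<n$, $G_{n,r}$ is the simple graph with vertex set $\{v_1,\dots,v_n\}$ and edge set $$\{v_iv_{i+1} : 1\le i\le n-r-1\}\cup\{v_1v_j,\ v_{n-r}v_j : n-r+1\le j\le n\}.$$ *)

(* Defs.v *)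
From HB Require Import structures.
From mathcomp Require Import all_boot all_order all_algebra.

Set Implicit Arguments.
Unset Strict Implicit.
Unset Printing Implicit Defensive.

Record sgraph := SGraph {
  vertex :> finType;
  adj : rel vertex;
  adj_sym : symmetric adj;
  adj_irr : irreflexive adj
}.

Definition connected_graph (G : sgraph) : Prop :=
  0 < #|G| /\ forall x y : G, connect (@adj G) x y.

Definition walk_of_length (G : sgraph) (x y : G) (k : nat) : bool :=
  [exists p : k.-tuple G, path (@adj G) x p && (last x p == y)].

(* Least length of a walk from x to y. Distances in a connected graph are
   less than #|G|, so the search range is sufficient; the value is #|G| when
   y is not reachable from x. *)
Definition dist (G : sgraph) (x y : G) : nat :=
  find (walk_of_length x y) (iota 0 #|G|).

Definition transmission (G : sgraph) (u : G) : nat := \sum_(x : G) dist u x.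

Definition STI (k : nat) (G : sgraph) : Prop :=
  [/\ 1 <= k, connected_graph G &
      forall x y : G, adj x y ->
        `|((transmission x)%:Z - (transmission y)%:Z)%R|%N = k].

(* Ordered pairs (a, b) of 1-based indices for which v_a v_b is listed as an edge. *)
Definition G_arc (n r a b : nat) : bool :=
  [|| (1 <= a <= n - r - 1) && (b == a + 1),
      (a == 1) && (n - r + 1 <= b <= n)
    | (a == n - r) && (n - r + 1 <= b <= n)].

(* The vertex v_i is the ordinal i - 1. *)
Definition G_adj (n r : nat) : rel 'I_n :=
  fun x y => G_arc n r x.+1 y.+1 || G_arc n r y.+1 x.+1.

Lemma G_adj_sym (n r : nat) : symmetric (@G_adj n r).
Proof. by move=> x y; rewrite /G_adj orbC. Qed.

Lemma G_adj_irr (n r : nat) : r < n -> irreflexive (@G_adj n r).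
Proof.
move=> hrn x; rewrite /G_adj orbb /G_arc !addn1.
have h : 0 < n - r by rewrite subn_gt0.
apply/negbTE; rewrite !negb_or !negb_and; apply/and3P; split.
- by rewrite neq_ltn ltnS leqnn !orbT.
- by case: (x : nat) => [|m] //=; rewrite -leqNgt h.
- by case: eqP => //= ->; rewrite ltnn.
Qed.

(* r < n is needed for looplessness: otherwise n - r = 0 and v_1 v_1 would be
   listed. *)
Definition G_graph (n r : nat) (hrn : r < n) : sgraph :=
  SGraph (@G_adj_sym n r) (G_adj_irr hrn).

(* Main.v *)
Require Import Defs.
From HB Require Import structures.
From mathcomp Require Import all_boot all_order all_algebra.
From mathcomp Require Import zify.

(** Put [m = n - r], which is odd.  Each of the [r] vertices [v_j], [j > m],
    closes the path [v_1 ... v_m] into an even cycle of length [m + 1], any two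
    of these vertices are at distance 2, and all other distances are cycle
    distances.  The distances from a vertex of a cycle to the whole cycle have
    a sum [S] which does not depend on the vertex, so
    [Tr x = S + (r - 1) e x], where [e x] is the distance from [x] to a further
    vertex [v_j], [j > m].  On an even cycle the distance to a fixed vertex
    changes by exactly 1 along every edge, hence so does [e]. *)

Lemma walk_of_lengthP (G : sgraph) (x y : G) (k : nat) :
  reflect (exists p : seq G, [/\ size p = k, path (@adj G) x p & last x p = y])
          (walk_of_length x y k).
Proof.
apply: (iffP existsP) => [[p /andP[xp /eqP yp]]|[p [<- xp yp]]].
  by exists p; rewrite size_tuple.
by exists (in_tuple p); rewrite xp yp eqxx.
Qed.

(** The bound [k < #|G|] is needed because [dist] searches only the lengths in [iota 0 #|G|]. *)
Lemma dist_eq (G : sgraph) (x y : G) (k : nat) :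
  k < #|G| -> walk_of_length x y k ->
  (forall j, walk_of_length x y j -> k <= j) -> dist x y = k.
Proof.
move=> kG wk kmin; rewrite /dist.
have hw : has (walk_of_length x y) (iota 0 #|G|).
  by apply/hasP; exists k => //; rewrite mem_iota.
have lt_find : find (walk_of_length x y) (iota 0 #|G|) < #|G|.
  by rewrite -[X in _ < X](size_iota 0) -has_find.
apply/eqP; rewrite eqn_leq; apply/andP; split.
  rewrite leqNgt; apply/negP => /(before_find 0).
  by rewrite nth_iota // add0n wk.
by apply: kmin; have := nth_find 0 hw; rewrite nth_iota.
Qed.

(** Upper half of a certificate for a guessed distance [d] to [y]: following edges that lower [d] by
    one must end at [y]. The lower half is [lipschitz_walk]. *)
Lemma descent_walk (G : sgraph) (d : G -> nat) (y : G) :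
  (forall x, d x = 0 -> x = y) ->
  (forall x k, d x = k.+1 -> exists2 z, adj x z & d z = k) ->
  forall x, walk_of_length x y (d x).
Proof.
move=> d0 dS x; move Dk: (d x) => k.
elim: k x Dk => [|k IHk] x Dx; apply/walk_of_lengthP.
  by exists [::]; split => //=; apply: d0.
have [z xz /IHk/walk_of_lengthP[p [sp zp yp]]] := dS _ _ Dx.
by exists (z :: p); rewrite /= sp xz.
Qed.

Lemma lipschitz_walk (G : sgraph) (d : G -> nat) (x y : G) (k : nat) :
  (forall u v, adj u v -> d u <= (d v).+1) ->
  walk_of_length x y k -> d x <= d y + k.
Proof.
move=> dL /walk_of_lengthP[p [<- + <-]].
elim: p x => [|z p IHp] x /=; first by rewrite addn0.
by case/andP=> /dL xz /IHp zp; lia.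
Qed.

Lemma connect_walk (G : sgraph) (x y : G) (k : nat) :
  walk_of_length x y k -> connect (@adj G) x y.
Proof. by case/walk_of_lengthP=> p [_ xp yp]; apply/connectP; exists p. Qed.

Definition cycle_dist (N k : nat) : nat := minn k (N - k).

(** Rotation invariance: positions [j >= i] give the offsets below [N - i]; positions [j < i] give
    the remaining ones after the reflection [k -> N - k], which preserves [cycle_dist N]. *)
Lemma sum_cycle_dist (N i : nat) : i <= N ->
  \sum_(0 <= j < N) cycle_dist N ((i - j) + (j - i)) =
  \sum_(0 <= k < N) cycle_dist N k.
Proof.
move=> iN; rewrite (big_cat_nat _ (n := i)) //=.
rewrite [RHS](big_cat_nat _ (n := N - i)) ?leq_subr //= addnC.
congr (_ + _).
  rewrite -{1}[i]add0n big_addn; apply: eq_big_nat => j _.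
  by congr cycle_dist; lia.
rewrite -{1}[N - i]add0n [RHS]big_addn (_ : N - (N - i) = i); last by lia.
by apply: eq_big_nat => j; rewrite /cycle_dist; lia.
Qed.

(* Vertices are numbered from 0; all [x >= m] sit at position [m] of the cycle
   of length [m + 1]. *)
Definition G_dist (m x y : nat) : nat :=
  if (m <= x) && (m <= y) then (if x == y then 0 else 2)
  else cycle_dist m.+1 ((minn x m - minn y m) + (minn y m - minn x m)).

(** The [e] of the overview. A vertex [x >= m] gets 2, not 0, since the further vertex differs from
    [x]. *)
Definition exit_dist (m x : nat) : nat :=
  if m <= x then 2 else cycle_dist m.+1 (m - x).

Lemma G_dist_lipschitz (n r x y z : nat) :
  r < n -> G_arc n r x.+1 y.+1 || G_arc n r y.+1 x.+1 ->
  G_dist (n - r) x z <= (G_dist (n - r) y z).+1.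
Proof. by rewrite /G_arc /G_dist /cycle_dist; do !case: ifP => ?; lia. Qed.

Lemma G_arc_intro (n r x z : nat) : r < n -> x < n -> z < n ->
  x < n - r /\ (z = x.+1 \/ x = 0 /\ n - r <= z) \/
  z < n - r /\ (x = z.+1 \/ z = 0 /\ n - r <= x) \/
  x = (n - r).-1 /\ n - r <= z \/ z = (n - r).-1 /\ n - r <= x ->
  G_arc n r x.+1 z.+1 || G_arc n r z.+1 x.+1.
Proof.
rewrite /G_arc => rn xn zn.
by case=> [[? [?|[? ?]]]|[[? [?|[? ?]]]|[[? ?]|[? ?]]]]; lia.
Qed.

(** The neighbour [z] is the next vertex on the shorter arc of the cycle from [x] to [y]. *)
Lemma G_dist_descent (n r x y k : nat) :
  0 < r < n -> x < n -> y < n -> G_dist (n - r) x y = k.+1 ->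
  exists z, [/\ z < n, G_arc n r x.+1 z.+1 || G_arc n r z.+1 x.+1
              & G_dist (n - r) z y = k].
Proof.
move=> hr xn yn; have [m0 mn] : 0 < n - r /\ n - r < n by lia.
have := @G_arc_intro n r x; move: (n - r) m0 mn => m m0 mn arcI Dk.
have step z : z < n ->
    x < m /\ (z = x.+1 \/ x = 0 /\ m <= z) \/
    z < m /\ (x = z.+1 \/ z = 0 /\ m <= x) \/
    x = m.-1 /\ m <= z \/ z = m.-1 /\ m <= x ->
    G_dist m z y = k ->
    exists z, [/\ z < n, G_arc n r x.+1 z.+1 || G_arc n r z.+1 x.+1
                & G_dist m z y = k].
  by move=> zn xz Dz; exists z; split => //; apply: arcI => //; case/andP: hr.
have D_lt u : u < m -> G_dist m u y =
    cycle_dist m.+1 ((u - minn y m) + (minn y m - u)).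
  by move=> um; rewrite /G_dist leqNgt um /= (minn_idPl (ltnW um)).
case: (leqP m x) => mx.
  case: (leqP m y) => my; move: Dk; rewrite {1}/G_dist mx.
    (* Two distinct vertices at position [m] are joined through the path end [0]. *)
    rewrite my /= => Dk; apply: (step 0); first lia; first lia.
    by rewrite D_lt /cycle_dist; case: eqP Dk => // _; lia.
  rewrite leqNgt my /= /cycle_dist => Dk.
  have [ym|ym] := leqP y.+1 (m - y).
    by apply: (step 0); rewrite ?D_lt /cycle_dist; lia.
  by apply: (step m.-1); rewrite ?D_lt /cycle_dist; lia.
rewrite (D_lt _ mx) in Dk.
case: (leqP (minn y m) x) => yx.
  have ym : y < m by lia.
  rewrite (minn_idPl (ltnW ym)) in Dk D_lt yx.
  case: (leqP (x - y) (m.+1 - (x - y))) => xym.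
    by apply: (step x.-1); rewrite ?D_lt; rewrite /cycle_dist in Dk *; lia.
  have [x1m|x1m] := ltnP x.+1 m.
    by apply: (step x.+1); rewrite ?D_lt; rewrite /cycle_dist in Dk *; lia.
  (* Here [x] is [m.-1] and the shorter arc crosses position [m] on its way to [y < m], so any
     vertex at that position would do. *)
  apply: (step m); [lia|lia|].
  by rewrite /G_dist leqnn leqNgt ym /=; rewrite /cycle_dist in Dk *; lia.
case: (leqP (minn y m - x) (m.+1 - (minn y m - x))) => xym.
  have [x1m|x1m] := ltnP x.+1 m.
    by apply: (step x.+1); rewrite ?D_lt; rewrite /cycle_dist in Dk *; lia.
  (* Now [y] itself lies at position [m]; the other vertices there are at distance 2 from it, so the
     step must go to [y]. *)
  apply: (step y); [lia|lia|].
  by rewrite /G_dist eqxx; rewrite /cycle_dist in Dk *; case: ifP => _; lia.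
(* The shorter arc runs backwards; from [0] it wraps around to position [m]. *)
case: (posnP x) => x0; last first.
  by apply: (step x.-1); rewrite ?D_lt; rewrite /cycle_dist in Dk *; lia.
case: (leqP m y) => my; last first.
  apply: (step m); [lia|lia|].
  by rewrite /G_dist leqnn leqNgt my /=; rewrite /cycle_dist in Dk *; lia.
apply: (step y); [lia|lia|].
by rewrite /G_dist eqxx; rewrite /cycle_dist in Dk *; case: ifP => _; lia.
Qed.

Lemma sum_G_dist (n r x : nat) : 0 < r < n -> x < n ->
  \sum_(0 <= y < n) G_dist (n - r) x y =
  \sum_(0 <= k < (n - r).+1) cycle_dist (n - r).+1 k
    + (r - 1) * exit_dist (n - r) x.
Proof.
move=> hr xn; set m := n - r.
have mn : m <= n by rewrite leq_subr.
rewrite (big_cat_nat _ (n := m)) //=.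
rewrite -(@sum_cycle_dist _ (minn x m)); last by lia.
(* The cycle sum takes the path vertices and a single vertex at position [m]; the other [r - 1]
   vertices there make up the [exit_dist] term. *)
rewrite big_nat_recr //= -addnA; congr (_ + _).
  apply: eq_big_nat => y /andP[_ ym].
  by rewrite /G_dist [m <= y]leqNgt ym andbF (minn_idPl (ltnW ym)).
rewrite /exit_dist; case: leqP => mx.
  rewrite (bigD1_seq x) ?mem_index_iota ?iota_uniq ?mx //=.
  rewrite {1}/G_dist mx eqxx add0n.
  rewrite big_seq_cond (eq_bigr (fun=> 2)); last first.
    move=> y /andP[]; rewrite mem_index_iota => /andP[my _] yx.
    by rewrite /G_dist mx my eq_sym (negbTE yx).
  rewrite -big_seq_cond.
  (* The terms other than the one at [x] are counted by removing that one from a constant sum over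
     all [r] vertices. *)
  have := big_const_nat 0 addn m n 2; rewrite iter_addn_0.
  rewrite (bigD1_seq x) ?mem_index_iota ?iota_uniq ?mx //=.
  by rewrite /cycle_dist /m in mx *; lia.
rewrite (eq_big_nat _ _ (F2 := fun=> cycle_dist m.+1 (m - x))); last first.
  move=> y /andP[my _]; rewrite /G_dist leqNgt mx /=.
  (* [x <= m] unfolds to [x - m == 0], so [eqP] turns it into a rewrite rule. *)
  by rewrite (minn_idPr my) (minn_idPl (ltnW mx)) (eqP (ltnW mx)) add0n.
rewrite big_const_nat iter_addn_0 subKn; last by lia.
rewrite (eqP (ltnW mx)) add0n.
by rewrite mulnC -mulSn; congr (_ * _); lia.
Qed.

(** As [m + 1] is even, no path edge joins two vertices equidistant from position [m]. On the
    remaining edges the values are 1 at a path end and 2 beyond it. *)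
Lemma exit_dist_adj (n r x y : nat) :
  odd (n - r) -> G_arc n r x.+1 y.+1 ->
  exit_dist (n - r) x = (exit_dist (n - r) y).+1 \/
  exit_dist (n - r) y = (exit_dist (n - r) x).+1.
Proof. by rewrite /G_arc /exit_dist /cycle_dist; do !case: ifP => ?; lia. Qed.

Lemma G_walk (n r : nat) (hrn : r < n) (x y : G_graph hrn) : 0 < r ->
  walk_of_length x y (G_dist (n - r) (x : 'I_n) (y : 'I_n)).
Proof.
move=> r0; apply: (@descent_walk _ (fun x : G_graph hrn =>
  G_dist (n - r) (x : 'I_n) (y : 'I_n))) => [u Du|u k Du].
  apply: val_inj; move: Du (ltn_ord (u : 'I_n)) (ltn_ord (y : 'I_n)) => /=.
  by rewrite /G_dist /cycle_dist; do !case: ifP => ?; lia.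
have [|||z [zn uz Dz]] := G_dist_descent _ _ _ _ _ _ _ _ Du.
- by rewrite r0.
- exact: ltn_ord.
- exact: ltn_ord.
by exists (Ordinal zn).
Qed.

Lemma dist_G_graph (n r : nat) (hrn : r < n) (x y : G_graph hrn) :
  2 < n -> 0 < r -> dist x y = G_dist (n - r) (x : 'I_n) (y : 'I_n).
Proof.
move=> n2 r0; apply: dist_eq; first 1 last.
- exact: G_walk.
- move=> j /(@lipschitz_walk _ (fun u : G_graph hrn =>
    G_dist (n - r) (u : 'I_n) (y : 'I_n))) /=.
  have -> : G_dist (n - r) (y : 'I_n) (y : 'I_n) = 0.
    by rewrite /G_dist /cycle_dist; do !case: ifP => ?; lia.
  by apply=> u v; apply: G_dist_lipschitz.
(* The search range suffices: cycle distances are at most [(m + 1) / 2], and the value 2 is covered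
   by [2 < n]. *)
rewrite card_ord; move: (ltn_ord (x : 'I_n)) (ltn_ord (y : 'I_n)).
by rewrite /G_dist /cycle_dist; do !case: ifP => ?; lia.
Qed.

Lemma transmission_G_graph (n r : nat) (hrn : r < n) (x : G_graph hrn) :
  2 < n -> 0 < r ->
  transmission x = \sum_(0 <= k < (n - r).+1) cycle_dist (n - r).+1 k
                     + (r - 1) * exit_dist (n - r) (x : 'I_n).
Proof.
move=> n2 r0.
rewrite -sum_G_dist; [|by rewrite r0|exact: (ltn_ord (x : 'I_n))].
by rewrite big_mkord; apply: eq_bigr => y _; apply: dist_G_graph.
Qed.

Theorem proposition4p4 (n r : nat) (hn : 5 <= n) (hr : 2 <= r) (hrn : r < n)
  (hmod : n = r - 1 %[mod 2]) :
  STI (r - 1) (G_graph hrn).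
Proof.
have n2 : 2 < n by lia.
have r0 : 0 < r by lia.
have odd_m : odd (n - r) by lia.
split; first by lia.
  split; first by rewrite card_ord; lia.
  by move=> x y; apply: connect_walk (G_walk _ _ _ _ _ r0).
move=> x y xy; rewrite !transmission_G_graph //.
have [|] : exit_dist (n - r) (x : 'I_n) = (exit_dist (n - r) (y : 'I_n)).+1 \/
           exit_dist (n - r) (y : 'I_n) = (exit_dist (n - r) (x : 'I_n)).+1.
- by case/orP: xy => /(exit_dist_adj _ _ _ _ odd_m) []; auto.
(* The common cycle sum cancels, leaving one copy of [r - 1]. *)
- by move=> ->; rewrite mulnS; lia.
- by move=> ->; rewrite mulnS; lia.
Qed.
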